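(* The only class of delta-matroids closed under handle slides is the class of binary delta-matroids; that is, the class of binary delta-matroids is closed under handle slides, and no non-binary delta-matroid belongs to a class of delta-matroids closed under handle slides.
   Context: A set system is a pair $(E,\mathcal{F})$ with $E$ finite and $\mathcal{F}$ a nonempty collection of subsets of $E$. A delta-matroid is a set system satisfying the symmetric exchange axiom: for all $F_1,F_2\in\mathcal{F}$ and $x\in F_1\Delta F_2$ there is $y\in F_1\Delta F_2$ with $F_1\Delta\{x,y\}\in\mathcal{F}$. For $A\subseteq E$, the twist is $D\star A=(E,\{A\Delta X: X\in\mathcal{F}\})$. For a symmetric matrix $A=(a_{vw})_{v,w\in E}$ over $GF(2)$ and $W\subseteq E$, let $A[W]=(a_{vw})_{v,w\in W}$, with the convention that $A[\emptyset]$ is invertible; then $D(A)=(E,\{W: A[W]\text{ is invertible}\})$. A delta-matroid $D=(E,\mathcal{F})$ is binary if there exist $F\in\mathcal{F}$ and a symmetric binary matrix $A$ with $D=D(A)\star F$. For a set system $D=(E,\mathcal{F})$ and $a,b\in E$ with $a\neq b$, the handle slide of $a$ over $b$ is $D_{ab}=(E,\mathcal{F}_{ab})$ where $\mathcal{F}_{ab}=\mathcal{F}\,\Delta\,\{X\cup\{a\} : X\cup\{b\}\in\mathcal{F},\ X\subseteq E-\{a,b\}\}$. A class of delta-matroids is closed (stable) under handle slides if for every $D=(E,\mathcal{F})$ in the class and every finite sequence $a_1,b_1,\dots,a_n,b_n\in E$ with $a_i\neq b_i$, the set system $(\cdots((D_{a_1b_1})_{a_2b_2})\cdots)_{a_nb_n}$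 is a delta-matroid belonging to the same class. *)

(* Defs.v *)
From HB Require Import structures.
From mathcomp Require Import all_boot all_algebra.

Set Implicit Arguments.
Unset Strict Implicit.
Unset Printing Implicit Defensive.

(* A set system (E, F) is a finite type E together with a family
   F : {set {set E}} satisfying set_system. *)
Definition set_system (E : finType) (F : {set {set E}}) : Prop := F != set0.

Definition symdiff (T : finType) (A B : {set T}) : {set T} :=
  (A :\: B) :|: (B :\: A).

(* y is allowed to be equal to x, in which case [set x; y] = [set x]. *)
Definition symmetric_exchange (E : finType) (F : {set {set E}}) : Prop :=
  forall F1 F2 : {set E}, F1 \in F -> F2 \in F ->
  forall x : E, x \in symdiff F1 F2 ->
  exists2 y : E, y \in symdiff F1 F2 & symdiff F1 [set x; y] \in F.

Definition delta_matroid (E : finType) (F : {set {set E}}) : Prop :=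
  set_system F /\ symmetric_exchange F.

Definition twist (E : finType) (F : {set {set E}}) (A : {set E}) :
  {set {set E}} := [set symdiff A X | X in F].

(* Rows and columns of A[W] are listed in the order of enum W; invertibility
   does not depend on this choice. *)
Definition principal_submx (E : finType) (A : E -> E -> 'F_2) (W : {set E}) :
  'M['F_2]_#|W| := (\matrix_(i, j) A (enum_val i) (enum_val j))%R.

(* A[set0] is a 0 x 0 matrix, and hence belongs to unitmx. *)
Definition dm_of_matrix (E : finType) (A : E -> E -> 'F_2) : {set {set E}} :=
  [set W : {set E} | principal_submx A W \in unitmx].

Definition symmetric_matrix (E : finType) (A : E -> E -> 'F_2) : Prop :=
  forall v w : E, A v w = A w v.

Definition binary_delta_matroid (E : finType) (D : {set {set E}}) : Prop :=
  delta_matroid D /\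
  exists (F : {set E}) (A : E -> E -> 'F_2),
    [/\ F \in D, symmetric_matrix A & D = twist (dm_of_matrix A) F].

(* The slide of a over b; it is only meaningful when a != b. *)
Definition handle_slide (E : finType) (F : {set {set E}}) (a b : E) :
  {set {set E}} :=
  symdiff F [set a |: X | X in [set X : {set E} |
                                 (X \subset ~: [set a; b]) && (b |: X \in F)]].

Definition handle_slides (E : finType) (F : {set {set E}}) (s : seq (E * E)) :
  {set {set E}} := foldl (fun G p => handle_slide G p.1 p.2) F s.

(* Membership need not be invariant under isomorphism. *)
Definition set_system_class := forall E : finType, {set {set E}} -> Prop.

Definition delta_matroid_class (C : set_system_class) : Prop :=
  forall (E : finType) (F : {set {set E}}), C E F -> delta_matroid F.

Definition closed_under_handle_slides (C : set_system_class) : Prop :=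
  forall (E : finType) (F : {set {set E}}), C E F ->
  forall s : seq (E * E), (forall p, p \in s -> p.1 != p.2) ->
  delta_matroid (handle_slides F s) /\ C E (handle_slides F s).

(* Main.v *)
Require Import Defs.
From mathcomp Require Import all_boot all_algebra ring.

Set Implicit Arguments.
Unset Strict Implicit.
Unset Printing Implicit Defensive.

Import GRing.Theory.

(* Slides preserve binarity: binary delta-matroids are the nonempty families
   [{W | rows X_i (i in W), Y_i (i notin W) are independent}] for square
   matrices X, Y with X^T Y symmetric, and the slide of a over b is the row
   operation X_a += X_b, Y_b += Y_a.

   Conversely, let all iterated slides of D be delta-matroids.  Sliding a over b
   removes K - b + a from D when K is feasible, and it does not affect the other
   sets K - b' + a'.  So starting from a feasible K of minimum size we reach a
   system D' whose feasible sets all contain K.  The feasible sets K + x and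
   K + x + y determine a symmetric matrix A such that D' and D(A) * K agree on
   every K + Z with |Z| <= 2; if they differ, let W be minimal such that they
   differ at K + W, and call G the one containing K + W and H the other one.
   Let S be a maximum proper subset of W with K + S in G.  Slides within W act on
   G and H in parallel, and after some of them no K + S - b + a is feasible.  For
   x in W - S, exchange in G from K towards K + W gives some K + {x, y} in G,
   hence in H, and exchange in H from K + S towards K + {x, y} then gives a
   feasible set which contradicts the choice of S.  Since slides are involutions,
   D is binary together with D'. *)

(** * Symmetric differences and handle slides *)

Lemma in_symdiff (T : finType) (A B : {set T}) x :
  (x \in symdiff A B) = (x \in A) (+) (x \in B).
Proof. by rewrite !inE; case: (x \in A); case: (x \in B). Qed.

Section Slides.
Variable E : finType.
Implicit Types (A B F K S W X Y Z : {set E}) (D G H : {set {set E}}) (a b x y : E).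

Lemma symdiffC A B : symdiff A B = symdiff B A.
Proof. by apply/setP=> x; rewrite !in_symdiff addbC. Qed.

Lemma symdiffA A B F : symdiff A (symdiff B F) = symdiff (symdiff A B) F.
Proof. by apply/setP=> x; rewrite !in_symdiff addbA. Qed.

Lemma symdiffK A B : symdiff A (symdiff A B) = B.
Proof. by apply/setP=> x; rewrite !in_symdiff addbA addbb. Qed.

Lemma symdiffxx A : symdiff A A = set0.
Proof. by apply/setP=> x; rewrite in_symdiff addbb inE. Qed.

Lemma symdiff0 A : symdiff A set0 = A.
Proof. by apply/setP=> x; rewrite in_symdiff inE addbF. Qed.

Lemma mem_twist D A X : (X \in twist D A) = (symdiff A X \in D).
Proof.
apply/imsetP/idP=> [[Y DY ->]|DX]; first by rewrite symdiffK.
by exists (symdiff A X); rewrite ?symdiffK.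
Qed.

Lemma mem_slide D a b Y : a != b ->
  (Y \in handle_slide D a b) =
  (Y \in D) (+) [&& a \in Y, b \notin Y & symdiff Y [set a; b] \in D].
Proof.
move=> ab; rewrite /handle_slide in_symdiff; congr (_ (+) _).
apply/imsetP/and3P=> [[X]|[aY bY DY]].
  rewrite inE => /andP[/subsetP sX DX] ->.
  have aX : a \notin X by apply/negP=> /sX; rewrite !inE eqxx.
  have bX : b \notin X by apply/negP=> /sX; rewrite !inE eqxx orbT.
  split; first by rewrite setU11.
    by rewrite !inE negb_or bX eq_sym ab.
  suff -> : symdiff (a |: X) [set a; b] = b |: X by [].
  apply/setP=> z; rewrite in_symdiff !inE.
  case: (eqVneq z a) => [->|_]; first by rewrite (negPf ab) (negPf aX).
  by case: (eqVneq z b) => [->|_] /=; rewrite ?(negPf bX) ?addbF.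
exists (Y :\ a); last by rewrite setD1K.
rewrite inE; apply/andP; split.
  apply/subsetP=> z; rewrite !inE negb_or => /andP[-> zY] /=.
  by apply: contraNneq bY => <-.
suff -> : b |: Y :\ a = symdiff Y [set a; b] by [].
apply/setP=> z; rewrite in_symdiff !inE.
case: (eqVneq z a) => [->|_]; first by rewrite (negPf ab) aY.
by case: (eqVneq z b) => [->|_] /=; rewrite ?(negPf bY) ?addbF.
Qed.

(** Toggled sets contain [a] and not [b], while the sets that decide the toggling contain [b] and
    not [a]. The latter are left alone, so a second slide toggles the same sets. *)
Lemma slideK D a b : a != b -> handle_slide (handle_slide D a b) a b = D.
Proof.
move=> ab; apply/setP=> Y; rewrite !mem_slide //.
rewrite !in_symdiff !inE !eqxx orbT /=.
case: (a \in Y); case: (b \in Y); rewrite /= ?addbF //.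
by rewrite -addbA addbb addbF.
Qed.

Lemma slide0 a b : a != b -> handle_slide (set0 : {set {set E}}) a b = set0.
Proof. by move=> ab; apply/setP=> Y; rewrite mem_slide // !inE !andbF. Qed.

Lemma slide_neq0 D a b : a != b -> D != set0 -> handle_slide D a b != set0.
Proof. by move=> ab; apply: contraNneq => D0; rewrite -(slideK D ab) D0 slide0. Qed.

Definition slides_in W (s : seq (E * E)) : bool :=
  all (fun p => [&& p.1 != p.2, p.1 \in W & p.2 \in W]) s.

Lemma slides_neq W s : slides_in W s -> forall p, p \in s -> p.1 != p.2.
Proof. by move=> /allP sW p /sW /and3P[]. Qed.

(** A set toggled by the slide of [a] over [b] contains [a], which is outside [F], and misses [b],
    which is in [F]. Among the sets [F - b' + a'] only [F - b + a] qualifies, so each slide lowers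
    [#|N D|]. *)
Lemma kill_neighbours D F W : F \in D ->
  exists s, [/\ slides_in W s, F \in handle_slides D s &
    forall a b, a \in W -> b \in W -> a \notin F -> b \in F ->
      symdiff F [set a; b] \notin handle_slides D s].
Proof.
pose N D' := [set p : E * E | [&& p.1 \in W, p.2 \in W, p.1 \notin F, p.2 \in F
                                & symdiff F [set p.1; p.2] \in D']].
have [n] := ubnP #|N D|; elim: n D => // n IH D ltn FD.
have [N0|[[a b] abN]] := set_0Vmem (N D).
  exists [::]; split=> // a b aW bW aF bF; apply/negP=> abD.
  by have := in_set0 (a, b); rewrite -N0 inE /= aW bW aF bF abD.
have := abN; rewrite inE /= => /and5P[aW bW aF bF abD].
have ab : a != b by apply: contraNneq aF => ->.
have [||s [sW FDs kill]] := IH (handle_slide D a b); last 1 first.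
- by exists ((a, b) :: s); split=> //=; rewrite ab aW bW.
- apply: (@leq_trans #|N D|) ltn; apply: proper_card.
  rewrite properE; apply/andP; split; last first.
    apply/subsetPn; exists (a, b) => //; rewrite inE /= mem_slide //.
    rewrite -symdiffA symdiffxx symdiff0 FD abD !in_symdiff !inE !eqxx orbT.
    by rewrite (negPf aF) bF !andbF.
  apply/subsetP=> -[a' b']; rewrite inE /= => /and5P[a'W b'W a'F b'F].
  rewrite [in X in _ -> X]inE /= a'W b'W a'F b'F /= mem_slide //.
  case: and3P => [[]|]; last by rewrite addbF.
  rewrite !in_symdiff !inE (negPf aF) bF /= negbK.
  rewrite [a == b'](contraNF _ aF) => [|/eqP->//].
  rewrite [b == a'](contraTF _ bF) => [|/eqP->//].
  by rewrite orbF => /eqP <- /eqP <-; rewrite abD.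
- by rewrite mem_slide // FD (negPf aF).
Qed.

(** * Slides within a set [W] disjoint from [K] *)

Section Local.
Variables (K W : {set E}).
Hypothesis KW : [disjoint K & W].

Lemma slide_sub D a b Z : a != b -> a \in W -> b \in W -> Z \subset W ->
  (K :|: Z \in handle_slide D a b) =
  (K :|: Z \in D) (+)
    [&& a \in Z, b \notin Z & K :|: symdiff Z [set a; b] \in D].
Proof.
move=> ab aW bW ZW; rewrite mem_slide // !inE.
rewrite (disjointFl KW aW) (disjointFl KW bW) /=.
suff -> : symdiff (K :|: Z) [set a; b] = K :|: symdiff Z [set a; b] by [].
apply/setP=> z; rewrite in_symdiff [in RHS]inE in_symdiff !inE.
have [zK|//] := boolP (z \in K); rewrite /=.
have zW := disjointFr KW zK.
have -> : (z == a) = false by apply: contraFF zW => /eqP->.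
by have -> : (z == b) = false by apply: contraFF zW => /eqP->.
Qed.

Lemma swap_sub a b Z : a \in W -> b \in W -> Z \subset W ->
  symdiff Z [set a; b] \subset W.
Proof.
move=> aW bW /subsetP ZW; apply/subsetP=> z; rewrite in_symdiff !inE.
by have [/ZW //|_] := boolP (z \in Z) => /orP[] /eqP->.
Qed.

Lemma card_swap a b Z : a \in Z -> b \notin Z -> #|symdiff Z [set a; b]| = #|Z|.
Proof.
move=> aZ bZ; have ab : a != b by apply: contraNneq bZ => <-.
have -> : symdiff Z [set a; b] = b |: Z :\ a.
  apply/setP=> z; rewrite in_symdiff !inE.
  case: (eqVneq z a) => [->|_]; first by rewrite (negPf ab) aZ.
  by case: (eqVneq z b) => [->|_] /=; rewrite ?(negPf bZ) ?addbF.
by rewrite cardsU1 !inE (negPf bZ) andbF (cardsD1 a Z) aZ.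
Qed.

(** A slide toggles a set according to another set of the same size, so an empty size class stays
    empty. *)
Lemma slides_card n D s : slides_in W s ->
  (forall Z, Z \subset W -> #|Z| = n -> K :|: Z \notin D) ->
  forall Z, Z \subset W -> #|Z| = n -> K :|: Z \notin handle_slides D s.
Proof.
elim: s D => //= -[a b] s IH D /andP[/= /and3P[ab aW bW] sW] nD.
apply: IH sW _ => Z ZW nZ; rewrite slide_sub // (negPf (nD _ ZW nZ)) /=.
apply/negP=> /and3P[aZ bZ]; apply/negP.
by rewrite nD ?swap_sub ?card_swap.
Qed.

(** [W] contains both [a] and [b], hence is neither toggled nor of the form [Z - a + b]. The
    disagreement at [W] can neither vanish nor spread. *)
Lemma slides_defect G H s : slides_in W s ->
  (forall Z, Z \subset W -> (K :|: Z \in G) = (K :|: Z \in H) (+) (Z == W)) ->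
  forall Z, Z \subset W ->
    (K :|: Z \in handle_slides G s) = (K :|: Z \in handle_slides H s) (+) (Z == W).
Proof.
elim: s G H => //= -[a b] s IH G H /andP[/= /and3P[ab aW bW] sW] GH.
apply: IH sW _ => Z ZW; rewrite !slide_sub // !GH ?swap_sub //.
rewrite -!addbA; congr (_ (+) _); rewrite addbC; congr (_ (+) _).
have [aZ|//] := boolP (a \in Z); have [//|bZ] := boolP (b \in Z); rewrite /=.
have -> : (symdiff Z [set a; b] == W) = false; last by rewrite addbF.
by apply: contraTF aW => /eqP <-; rewrite in_symdiff !inE aZ eqxx.
Qed.

Lemma slides_ends D s Z : slides_in W s -> Z = set0 \/ Z = W ->
  (K :|: Z \in handle_slides D s) = (K :|: Z \in D).
Proof.
move=> sW Z0W; elim: s D sW => //= -[a b] s IH D /andP[/= /and3P[ab aW bW] sW].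
rewrite IH // slide_sub //; last by case: Z0W => ->; rewrite ?sub0set.
by case: Z0W => ->; rewrite ?inE ?bW ?andbF addbF.
Qed.

Lemma symdiff_sub A B : A \subset W -> B \subset W -> symdiff A B \subset W.
Proof.
by move=> sA sB; rewrite subUset !subDset !(subset_trans _ (subsetUr _ _)).
Qed.

Lemma symdiff_disjoint A B : A \subset W -> B \subset W ->
  symdiff (K :|: A) B = K :|: symdiff A B.
Proof.
move=> sA sB; apply/setP=> z; rewrite in_symdiff [in RHS]inE in_symdiff inE.
have [zK|//] := boolP (z \in K).
by rewrite (contraFF (subsetP sB z) (disjointFr KW zK)).
Qed.

Lemma exchange_sub D A B x : symmetric_exchange D ->
  A \subset W -> B \subset W -> K :|: A \in D -> K :|: B \in D ->
  x \in symdiff A B ->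
  exists2 y, y \in symdiff A B & K :|: symdiff A [set x; y] \in D.
Proof.
move=> exD sA sB DA DB; have eqAB : symdiff (K :|: A) (K :|: B) = symdiff A B.
  apply/setP=> z; rewrite !in_symdiff !inE.
  have [zK|//] := boolP (z \in K); have zW := disjointFr KW zK.
  by rewrite (contraFF (subsetP sA z) zW) (contraFF (subsetP sB z) zW).
rewrite -eqAB => xAB; have [y yAB Dy] := exD _ _ DA DB _ xAB.
exists y => //; rewrite -symdiff_disjoint //.
have sAB := subsetP (symdiff_sub sA sB).
by rewrite subUset !sub1set !sAB // -eqAB.
Qed.

Definition slide_stable D :=
  forall s, (forall p, p \in s -> p.1 != p.2) -> delta_matroid (handle_slides D s).

Lemma no_defect G H : slide_stable G -> slide_stable H -> 2 < #|W| ->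
  K \in G -> K :|: W \in G ->
  ~ (forall Z, Z \subset W -> (K :|: Z \in G) = (K :|: Z \in H) (+) (Z == W)).
Proof.
move=> stG stH W3 KG WG GH.
have W0 : set0 != W by apply: contraTneq W3 => <-; rewrite cards0.
pose P := [pred Z : {set E} | (Z \proper W) && (K :|: Z \in G)].
have P0 : P set0 by rewrite /= setU0 KG proper0 eq_sym W0.
have [S /= /andP[SW SG] maxS] := @arg_maxnP _ set0 P (fun Z => #|Z|) P0.
have sSW := proper_sub SW.
have [s [sW SGs kill]] := kill_neighbours W SG.
set G' := handle_slides G s in SGs kill; pose H' := handle_slides H s.
have ss := slides_neq sW.
have GH' := slides_defect sW GH; rewrite -/G' -/H' in GH'.
have [_ exG] : delta_matroid G' := stG s ss.
have [_ exH] : delta_matroid H' := stH s ss.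
have same Z : Z \subset W -> Z != W -> (K :|: Z \in H') = (K :|: Z \in G').
  by move=> ZW /negPf nZ; rewrite GH' // nZ addbF.
(* [H] lacks [K :|: W] and agrees with [G] on proper subsets of [W], so the maximality of [S] bounds
   [H] as well, and sliding preserves sizes. *)
have maxH Z : Z \subset W -> #|S| < #|Z| -> K :|: Z \notin H'.
  move=> ZW ltSZ; apply: (slides_card (n := #|Z|) sW _ ZW) => // Y YW YZ.
  apply/negP=> YH; have [eqYW|neqYW] := eqVneq Y W.
    by have := GH Y YW; rewrite YH eqYW WG eqxx.
  have PY : P Y by rewrite /= properEneq neqYW YW GH // YH (negPf neqYW).
  by have := maxS Y PY; rewrite leqNgt YZ ltSZ.
have K0G : K :|: set0 \in G' by rewrite (slides_ends _ sW) ?setU0; auto.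
have KWG : K :|: W \in G' by rewrite (slides_ends _ sW); auto.
have /properP[_ [x xW xS]] := SW.
have [|y yW xyG] := exchange_sub (x := x) exG (sub0set W) (subxx W) K0G KWG.
  by rewrite in_symdiff !inE.
have {}yW : y \in W by rewrite in_symdiff inE in yW.
rewrite symdiffC symdiff0 in xyG.
have sxy : [set x; y] \subset W by rewrite subUset !sub1set xW.
(* [y] may equal [x]; in either case the pair is too small to be [W], so [G'] and [H'] agree on
   it. *)
have xyW : [set x; y] != W.
  by apply: contraTneq W3 => <-; rewrite cards2 -leqNgt; case: (x != y).
have SH : K :|: S \in H' by rewrite same // proper_neq.
rewrite -same // in xyG.
have [|z zS] := exchange_sub (x := x) exH sSW sxy SH xyG.
  by rewrite in_symdiff !inE eqxx (negPf xS).
have zW : z \in W by apply: (subsetP (symdiff_sub sSW sxy)).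
have sS' : symdiff S [set x; z] \subset W.
  by rewrite symdiff_sub // subUset !sub1set xW.
(* If [z] is in [S], the new set is a neighbour of [K :|: S] that the slides have removed; otherwise
   it is larger than [S], against [maxH]. *)
apply/negP; have [zS'|zS'] := boolP (z \in S).
  rewrite same //.
    rewrite -symdiff_disjoint ?subUset ?sub1set ?xW //.
    by apply: kill; rewrite // inE ?negb_or ?zS' ?orbT // xS (disjointFl KW xW).
  apply: contraTneq zS' => eqW.
  have := zW; rewrite -eqW in_symdiff !inE eqxx orbT addbT.
  by move/negPf->.
apply: maxH => //; apply: proper_card; apply/properP; split.
  apply/subsetP=> t tS; rewrite in_symdiff tS !inE /= negb_or.
  by rewrite !(contraTneq _ tS) // => ->.
by exists x => //; rewrite in_symdiff !inE eqxx (negPf xS).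
Qed.
End Local.
End Slides.

(** * Arithmetic over GF(2) *)

Section LinearAlgebra.
Local Open Scope ring_scope.

Lemma addFF (x : 'F_2) : x + x = 0.
Proof. by apply: addrr_pchar2; apply: pchar_Fp. Qed.

Lemma oppFF (x : 'F_2) : - x = x.
Proof. by apply: oppr_pchar2; apply: pchar_Fp. Qed.

Lemma addFF_eq0 (x y : 'F_2) : x + y = 0 -> x = y.
Proof. by move=> /eqP; rewrite addr_eq0 oppFF => /eqP. Qed.

Lemma addFF_neq0 (x y : 'F_2) : (x + y != 0) = (x != 0) (+) (y != 0).
Proof.
by case: x => [[|[|x]] xP]; case: y => [[|[|y]] yP].
Qed.

Lemma natFF_neq0 (b : bool) : ((b%:R : 'F_2) != 0) = b.
Proof. by case: b. Qed.

Lemma FF_eq (x y : 'F_2) : (x != 0) = (y != 0) -> x = y.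
Proof.
move=> xy; apply: addFF_eq0; apply/eqP.
by rewrite -[_ == 0]negbK addFF_neq0 xy addbb.
Qed.

(** In characteristic 2 the terms at [(p, q)] and [(q, p)] cancel, and the diagonal ones vanish with
    [g p p]. *)
Lemma sum_sym_alternating n (S g : 'I_n -> 'I_n -> 'F_2) :
  (forall p q, S p q = S q p) -> (forall p q, g p q = g q p) ->
  (forall p, g p p = 0) -> \sum_p \sum_q S p q * g p q = 0.
Proof.
move=> symS symg diag.
pose up := \sum_(p < n) \sum_(q < n | (p < q)%N) S p q * g p q.
pose dn := \sum_(p < n) \sum_(q < n | (q < p)%N) S p q * g p q.
have -> : \sum_p \sum_q S p q * g p q = up + dn.
  rewrite -big_split; apply: eq_bigr => p _ /=.
  rewrite (bigID (fun q : 'I_n => (p < q)%N)) /=; congr (_ + _).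
  rewrite (bigID (fun q : 'I_n => (q < p)%N)) /= addrC big1 ?add0r => [|q].
    by apply: eq_bigl => q; case: ltngtP.
  by case: ltngtP => // /val_inj ->; rewrite diag mulr0.
rewrite /dn (exchange_big_dep xpredT) //=.
under eq_bigr do under eq_bigr do rewrite symS symg.
exact: addFF.
Qed.

(** * Determinants as functions of one or two rows *)

Section Rows.
Variable n : nat.
Implicit Types (M X Y : 'M['F_2]_n) (u v : 'rV['F_2]_n) (a b : 'I_n).

Definition set_row M a u : 'M['F_2]_n :=
  \matrix_(i, j) if i == a then u 0 j else M i j.

Lemma det_set_row M a u : \det (set_row M a u) = \sum_j u 0 j * cofactor M a j.
Proof.
rewrite (expand_det_row _ a); apply: eq_bigr => j _; rewrite mxE eqxx.
congr (_ * (_ * \det _)); apply/matrixP=> i k; rewrite !mxE.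
by rewrite eq_sym (negPf (neq_lift _ _)).
Qed.

Lemma det_set_rowD M a u v :
  \det (set_row M a (u + v)) = \det (set_row M a u) + \det (set_row M a v).
Proof.
by rewrite !det_set_row -big_split; apply: eq_bigr => j _; rewrite mxE mulrDl.
Qed.

Lemma set_rowC M a b u v : a != b ->
  set_row (set_row M a u) b v = set_row (set_row M b v) a u.
Proof.
move=> ab; apply/matrixP=> i j; rewrite !mxE.
by case: (eqVneq i b) => // ->; rewrite eq_sym (negPf ab).
Qed.

Lemma det_eq_rows M a b : a != b -> row a M = row b M -> \det M = 0.
Proof.
move=> ab /rowP eqM; apply: (determinant_alternate ab) => j.
by have := eqM j; rewrite !mxE.
Qed.

(** An alternating bilinear form is antisymmetric, hence symmetric in characteristic 2: expand
    [f (u + v) (u + v) = 0]. *)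
Lemma det_set_row2C M a b u v : a != b ->
  \det (set_row (set_row M b v) a u) = \det (set_row (set_row M b u) a v).
Proof.
move=> ab; apply: addFF_eq0; have ba : b != a by rewrite eq_sym.
pose f w z := \det (set_row (set_row M b w) a z).
have f0 w : f w w = 0.
  by apply: (det_eq_rows ab); apply/rowP=> j; rewrite !mxE eqxx (negPf ba) eqxx.
have fDr w z t : f w (z + t) = f w z + f w t by apply: det_set_rowD.
have fDl w z t : f (w + z) t = f w t + f z t.
  by rewrite /f -!(set_rowC _ _ _ ab) det_set_rowD.
by have := f0 (u + v); rewrite fDl !fDr !f0 add0r addr0 addrC.
Qed.

Lemma det_set_row2 M a b u v : a != b ->
  \det (set_row (set_row M b v) a u) = \sum_p \sum_q
     (u 0 p * v 0 q) * \det (set_row (set_row M b (delta_mx 0 q)) a (delta_mx 0 p)).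
Proof.
move=> ab; have setE N c w :
    \det (set_row N c w) = \sum_p w 0 p * \det (set_row N c (delta_mx 0 p)).
  rewrite det_set_row; apply: eq_bigr => p _; rewrite det_set_row (bigD1 p) //=.
  rewrite mxE !eqxx mul1r big1 ?addr0 // => j jp.
  by rewrite mxE (negPf jp) andbF mul0r.
rewrite setE; apply: eq_bigr => p _; rewrite -(set_rowC _ _ _ ab) setE big_distrr /=.
by apply: eq_bigr => q _; rewrite mulrA (set_rowC _ _ _ ab).
Qed.

(** The columns of [X] stacked on [Y] span a totally isotropic subspace for the standard symplectic
    form. *)
Definition isotropic X Y := X^T *m Y = Y^T *m X.

(* The alternating form [(u, v) |-> det (M with rows u at a and v at b)] kills
   the symmetric tensor [X^T *m Y], and it kills [row i X (x) row i Y] for each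
   i other than a, b. *)
Lemma isotropic_minors X Y M a b : isotropic X Y -> a != b ->
  (forall i, i != a -> i != b -> row i M = row i X \/ row i M = row i Y) ->
  \det (set_row (set_row M b (row a Y)) a (row a X)) =
  \det (set_row (set_row M b (row b Y)) a (row b X)).
Proof.
move=> XY ab RM; have ba : b != a by rewrite eq_sym.
pose f i := \det (set_row (set_row M b (row i Y)) a (row i X)).
have f0 i : i != a -> i != b -> f i = 0.
  move=> ia ib; have ai : a != i by rewrite eq_sym.
  have bi : b != i by rewrite eq_sym.
  have [/rowP Mi|/rowP Mi] := RM i ia ib.
    apply: (det_eq_rows ai); apply/rowP=> j; have := Mi j.
    by rewrite !mxE eqxx (negPf ia) (negPf ib) => ->.
  apply: (det_eq_rows bi); apply/rowP=> j; have := Mi j.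
  by rewrite !mxE eqxx (negPf ba) (negPf ia) (negPf ib) => ->.
suff : \sum_i f i = 0.
  rewrite (bigD1 a) // (bigD1 b) //= big1 ?addr0; first exact: addFF_eq0.
  by move=> i /andP[]; apply: f0.
rewrite /f; under eq_bigr => i _ do rewrite det_set_row2 //.
rewrite exchange_big /=; under eq_bigr => p _ do rewrite exchange_big /=.
pose g p q := \det (set_row (set_row M b (delta_mx 0 q)) a (delta_mx 0 p)).
transitivity (\sum_p \sum_q (X^T *m Y) p q * g p q).
  apply: eq_bigr => p _; apply: eq_bigr => q _; rewrite mxE big_distrl /=.
  by apply: eq_bigr => i _; rewrite !mxE.
apply: sum_sym_alternating => [p q|p q|p].
- by rewrite {1}XY -[Y^T *m X]trmxK trmx_mul trmxK mxE.
- exact: det_set_row2C.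
- rewrite /g; apply: (det_eq_rows ab); apply/rowP=> j.
  by rewrite !mxE !eqxx (negPf ba).
Qed.
End Rows.

(** * Binary delta-matroids from isotropic pairs of matrices *)

Section Binary.
Variable E : finType.
Notation n := #|E|.
Implicit Types (X Y M : 'M['F_2]_n) (W F : {set E}) (D : {set {set E}})
  (A : E -> E -> 'F_2).

Definition mix_rows X Y W : 'M['F_2]_n :=
  \matrix_(i, j) if enum_val i \in W then X i j else Y i j.

(** A member [W] forces the stacked matrix to have rank [n], so that its columns span a Lagrangian
    subspace. Nonemptiness is tracked separately in [binaryP]. *)
Definition lagrangian D := exists X Y,
  isotropic X Y /\ forall W, (W \in D) = (\det (mix_rows X Y W) != 0).

(** Split by rows, the condition is visibly unaffected by exchanging row [i] of [X] with row [i] of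
    [Y], and a change of two rows touches two summands only. *)
Lemma isotropicP X Y :
  isotropic X Y <-> forall p q, \sum_i (X i p * Y i q + Y i p * X i q) = 0.
Proof.
have trE Z T p q : (Z^T *m T) p q = \sum_i Z i p * T i q.
  by rewrite mxE; apply: eq_bigr => i _; rewrite mxE.
split=> [/matrixP XY p q|XY].
  by rewrite big_split -!trE /= XY addFF.
apply/matrixP=> p q; apply: addFF_eq0; rewrite !trE -big_split /=; apply: XY.
Qed.

Lemma isotropic_mix X Y W :
  isotropic X Y -> isotropic (mix_rows Y X W) (mix_rows X Y W).
Proof.
move=> /isotropicP XY; apply/isotropicP=> p q; rewrite -[RHS](XY p q).
by apply: eq_bigr => i _; rewrite !mxE; case: ifP => // _; rewrite addrC.
Qed.

Lemma mix_twist X Y F W :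
  mix_rows (mix_rows Y X F) (mix_rows X Y F) (symdiff F W) = mix_rows X Y W.
Proof.
apply/matrixP=> i j; rewrite !mxE in_symdiff.
by case: (_ \in F); case: (_ \in W).
Qed.

Lemma unitmx_kerP m (M : 'M['F_2]_m) :
  reflect (forall v : 'cV_m, M *m v = 0 -> v = 0) (\det M != 0).
Proof.
rewrite -unitfE -unitmxE -unitmx_tr -row_free_unit.
apply: (iffP idP) => [Mfree v Mv|kerM].
  apply: trmx_inj; apply: (row_free_inj Mfree).
  by rewrite -trmx_mul Mv !trmx0 mul0mx.
apply: inj_row_free => v vM; apply: trmx_inj; rewrite trmx0; apply: kerM.
by apply: trmx_inj; rewrite trmx_mul trmxK vM trmx0.
Qed.

(** Kernel vectors of [A[W]] are encoded as functions on [E] that vanish off [W], which avoids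
    matrices whose size depends on [W]. *)
Definition nonsingular A W := forall v : E -> 'F_2,
  (forall x, x \notin W -> v x = 0) ->
  (forall x, x \in W -> \sum_y A x y * v y = 0) -> forall x, v x = 0.

Lemma mem_dmP A W : reflect (nonsingular A W) (W \in dm_of_matrix A).
Proof.
rewrite inE unitmxE unitfE; apply: (iffP (unitmx_kerP _)) => [ker v v0 Av x|ns v Av].
  have [xW|] := boolP (x \in W); last exact: v0.
  suff /matrixP/(_ (enum_rank_in xW x) 0) : \col_i v (enum_val i) = 0 :> 'cV_#|W|.
    by rewrite !mxE enum_rankK_in.
  apply: ker.
  apply/matrixP=> i j; rewrite !mxE -[RHS](Av (enum_val i) (enum_valP i)).
  rewrite [RHS](bigID (mem W)) /= [X in _ + X]big1 ?addr0 => [|y yW]; last first.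
    by rewrite v0 ?mulr0.
  by rewrite [RHS]big_enum_val; apply: eq_bigr => k _; rewrite !mxE.
(* An empty [W] is set apart because [enum_rank_in] needs an element of it. *)
have [W0|[x0 x0W]] := set_0Vmem W.
  by apply/matrixP=> i; have := in_set0 (enum_val i); rewrite -W0 enum_valP.
pose w x := if x \in W then v (enum_rank_in x0W x) 0 else 0.
have w0 : forall x, w x = 0.
  apply: ns => [x /negPf xW|x xW]; first by rewrite /w xW.
  move/matrixP/(_ (enum_rank_in x0W x) 0): Av.
  rewrite !mxE => Av0; rewrite -[RHS]Av0.
  rewrite (bigID (mem W)) /= [X in _ + X]big1 ?addr0 => [|y yW]; last first.
    by rewrite /w (negPf yW) mulr0.
  rewrite big_enum_val; apply: eq_bigr => k _; rewrite !mxE enum_rankK_in //.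
  by rewrite /w enum_valP enum_valK_in.
apply/matrixP=> i j; rewrite ord1 mxE -(w0 (enum_val i)).
by rewrite /w enum_valP enum_valK_in.
Qed.

(** The identity rows outside [W] force a kernel vector to vanish there, which leaves the kernel of
    [A[W]]. *)
Lemma mem_dm_mix A W : (W \in dm_of_matrix A) =
  (\det (mix_rows (\matrix_(i, j) A (enum_val i) (enum_val j)) 1%:M W) != 0).
Proof.
apply/mem_dmP/unitmx_kerP => [ns v Mv|ker v v0 Av x].
  have w0 := ns (fun x => v (enum_rank x) 0).
  apply/matrixP=> i j; rewrite ord1 mxE -[i]enum_valK; apply: w0 => {i} x xW.
    have /matrixP/(_ (enum_rank x) 0) := Mv; rewrite !mxE => <-.
    rewrite (bigD1 (enum_rank x)) //= !mxE enum_rankK (negPf xW) eqxx mul1r.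
    rewrite big1 ?addr0 // => k kx.
    by rewrite !mxE enum_rankK (negPf xW) eq_sym (negPf kx) mul0r.
  have /matrixP/(_ (enum_rank x) 0) := Mv; rewrite !mxE => Mv0; rewrite -[RHS]Mv0.
  rewrite (reindex (fun k : 'I_n => enum_val k)) /=; last first.
    exact: onW_bij (enum_val_bij _).
  by apply: eq_bigr => k _; rewrite !mxE enum_rankK xW enum_valK.
suff /matrixP/(_ (enum_rank x) 0) : \col_i v (enum_val i) = 0 :> 'cV_n.
  by rewrite !mxE enum_rankK.
apply: ker; apply/matrixP=> i j; rewrite !mxE.
have [iW|iW] := boolP (enum_val i \in W).
  rewrite -[RHS](Av _ iW) [RHS](reindex (fun k : 'I_n => enum_val k)) /=; last first.
    exact: onW_bij (enum_val_bij _).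
  by apply: eq_bigr => k _; rewrite !mxE iW.
rewrite big1 // => k _; rewrite !mxE (negPf iW).
by case: eqVneq => [<-|_]; rewrite ?mul0r // v0 ?mulr0.
Qed.

(** [D(A)] comes from the pair [(A, 1)], isotropic since [A] is symmetric, and a twist by [F]
    exchanges the two matrices on the rows of [F]. *)
Lemma lagrangian_twist A F :
  symmetric_matrix A -> lagrangian (twist (dm_of_matrix A) F).
Proof.
move=> symA; pose M := \matrix_(i < n, j < n) A (enum_val i) (enum_val j).
exists (mix_rows 1%:M M F), (mix_rows M 1%:M F); split.
  apply: isotropic_mix; rewrite /isotropic trmx1 mulmx1 mul1mx.
  by apply/matrixP=> i j; rewrite !mxE.
by move=> W; rewrite mem_twist mem_dm_mix -(mix_twist _ _ F) symdiffK.
Qed.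

(** Column operations preserve the family. As [M], the rows selected by [F], is invertible,
    multiplying by its inverse turns [(N, M)] into [(B, 1)], and isotropy makes [B] symmetric. *)
Lemma lagrangian_matrix D F : lagrangian D -> F \in D ->
  exists A, symmetric_matrix A /\ D = twist (dm_of_matrix A) F.
Proof.
move=> [X [Y [XY memD]]] FD; set M := mix_rows X Y F; set N := mix_rows Y X F.
have Mu : M \in unitmx by rewrite unitmxE unitfE -memD.
have NM : isotropic N M by apply: isotropic_mix.
pose B := N *m invmx M.
have symB : B^T = B.
  have eqN : N^T = M^T *m N *m invmx M by rewrite -NM mulmxK.
  by rewrite /B trmx_mul trmx_inv eqN -mulmxA mulKmx ?unitmx_tr.
exists (fun x y => B (enum_rank x) (enum_rank y)); split.
  by move=> x y; rewrite -{1}symB mxE.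
apply/setP=> W; rewrite mem_twist mem_dm_mix memD -(mix_twist X Y F) -/N -/M.
have -> : \matrix_(i, j) B (enum_rank (enum_val i)) (enum_rank (enum_val j)) = B.
  by apply/matrixP=> i j; rewrite mxE !enum_valK.
suff -> : mix_rows N M (symdiff F W) = mix_rows B 1%:M (symdiff F W) *m M.
  by rewrite det_mulmx mulf_eq0 negb_or -memD FD andbT.
have eqN : N = B *m M by rewrite mulmxKV.
apply/matrixP=> i j; rewrite [LHS]mxE {1}eqN -{2}[M]mul1mx !mxE.
by case: ifP => iW; apply: eq_bigr => k _; rewrite ?mxE iW.
Qed.

(** Multilinearity in rows [i] and [k]. Both changed rows are selected only when [a \in W] and
    [b \notin W]; otherwise at most one is, and what is added to it is another selected row. *)
Lemma det_mix_slide X Y a b W : a != b -> isotropic X Y ->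
  let i := enum_rank a in let k := enum_rank b in
  \det (mix_rows (set_row X i (row i X + row k X))
                 (set_row Y k (row k Y + row i Y)) W) =
  \det (mix_rows X Y W) +
    if (a \in W) && (b \notin W)
    then \det (mix_rows X Y (symdiff W [set a; b])) else 0.
Proof.
move=> ab XY i k; have ik : i != k by apply: contraNneq ab => /enum_rank_inj->.
have ki : k != i by rewrite eq_sym.
have ia : enum_val i = a by apply: enum_rankK.
have kb : enum_val k = b by apply: enum_rankK.
have neq j : j != i -> j != k -> enum_val j \notin [set a; b].
  move=> ji jk; rewrite !inE -ia -kb.
  by rewrite !(inj_eq enum_val_inj) negb_or ji.
set R := mix_rows X Y W.
have [aW|aW] := boolP (a \in W); have [bW|bW] := boolP (b \in W); rewrite /= ?addr0.
- transitivity (\det (set_row R i (row i X + row k X))).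
    congr (\det _); apply/matrixP=> j l; rewrite !mxE.
    case: (eqVneq j i) => [->|ji]; first by rewrite ia aW.
    by case: (eqVneq j k) => [->|jk] //; rewrite kb bW.
  rewrite det_set_rowD [X in _ + X](@det_eq_rows _ _ i k) ?addr0 //.
    congr (\det _); apply/matrixP=> j l; rewrite !mxE.
    by case: (eqVneq j i) => [->|ji] //; rewrite ia aW.
  by apply/rowP=> l; rewrite !mxE eqxx (negPf ki) kb bW.
- pose t u v := \det (set_row (set_row R k v) i u).
  have tD u u' v v' : t (u + u') (v + v') = (t u v + t u v') + (t u' v + t u' v').
    by rewrite /t det_set_rowD -!(set_rowC _ _ _ ik) !det_set_rowD.
  transitivity (t (row i X + row k X) (row k Y + row i Y)).
    congr (\det _); apply/matrixP=> j l; rewrite !mxE.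
    case: (eqVneq j i) => [->|ji]; first by rewrite ia aW.
    by case: (eqVneq j k) => [->|jk] //; rewrite kb (negPf bW).
  (* Of the four terms of the expansion, these two cancel by isotropy; the others are the
     determinants for [W] and for [symdiff W [set a; b]]. *)
  have tXY : t (row i X) (row i Y) = t (row k X) (row k Y).
    apply: isotropic_minors => // j ji jk.
    have [jW|jW] := boolP (enum_val j \in W); [left|right]; apply/rowP=> l.
      by rewrite !mxE jW.
    by rewrite !mxE (negPf jW).
  rewrite tD tXY addrA -[X in X + _ = _]addrA addFF addr0; congr (_ + _).
    congr (\det _); apply/matrixP=> j l; rewrite !mxE.
    case: (eqVneq j i) => [->|ji]; first by rewrite ia aW.
    by case: (eqVneq j k) => [->|jk] //; rewrite kb (negPf bW).
  rewrite /t det_set_row2C //; congr (\det _); apply/matrixP=> j l.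
  rewrite !mxE in_symdiff.
  case: (eqVneq j i) => [->|ji]; first by rewrite ia aW !inE eqxx.
  case: (eqVneq j k) => [->|jk]; first by rewrite kb (negPf bW) !inE eqxx orbT.
  by rewrite (negPf (neq j ji jk)) addbF.
- congr (\det _); apply/matrixP=> j l; rewrite !mxE.
  case: (eqVneq j i) => [->|ji]; first by rewrite ia (negPf aW) (negPf ik).
  by case: (eqVneq j k) => [->|jk] //; rewrite kb bW.
- transitivity (\det (set_row R k (row k Y + row i Y))).
    congr (\det _); apply/matrixP=> j l; rewrite !mxE.
    case: (eqVneq j i) => [->|ji]; first by rewrite ia (negPf aW) (negPf ik).
    by case: (eqVneq j k) => [->|jk] //; rewrite kb (negPf bW).
  rewrite det_set_rowD [X in _ + X](@det_eq_rows _ _ k i) ?addr0 //.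
    congr (\det _); apply/matrixP=> j l; rewrite !mxE.
    by case: (eqVneq j k) => [->|jk] //; rewrite kb (negPf bW).
  by apply/rowP=> l; rewrite !mxE eqxx (negPf ik) ia (negPf aW).
Qed.

Lemma isotropic_slide X Y i k : i != k -> isotropic X Y ->
  isotropic (set_row X i (row i X + row k X)) (set_row Y k (row k Y + row i Y)).
Proof.
move=> ik /isotropicP XY; have ki : k != i by rewrite eq_sym.
apply/isotropicP=> p q; rewrite -[RHS](XY p q).
rewrite [LHS](bigD1 i) // [RHS](bigD1 i) //= [X in _ + X](bigD1 k) //=.
rewrite [X in _ = _ + X](bigD1 k) //= !mxE !eqxx (negPf ik) (negPf ki).
under [X in _ + (_ + X) = _]eq_bigr => j /andP[/negPf ji /negPf jk].
  rewrite !mxE ji jk; over.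
rewrite /= !addrA; congr (_ + _).
(* The slide adds [t] once through row [i] and once through row [k], so the two copies cancel. *)
set t := X k p * Y i q + Y i p * X k q.
by rewrite -[RHS]addr0 -(addFF t) /t; ring.
Qed.

Lemma lagrangian_slide D a b :
  a != b -> lagrangian D -> lagrangian (handle_slide D a b).
Proof.
move=> ab [X [Y [XY memD]]].
have ik : enum_rank a != enum_rank b by rewrite (inj_eq enum_rank_inj).
pose i := enum_rank a; pose k := enum_rank b.
exists (set_row X i (row i X + row k X)), (set_row Y k (row k Y + row i Y)).
split; first exact: isotropic_slide.
move=> W; rewrite det_mix_slide // addFF_neq0 mem_slide // memD; congr (_ (+) _).
rewrite andbA memD; case: ifP => _ //=.
Qed.

(** Otherwise the indicator of [x] would be a nonzero kernel vector of [A[W]]; symmetry turns the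
    zero row into a zero column. *)
Lemma nonsingular_row A W x : symmetric_matrix A -> nonsingular A W -> x \in W ->
  exists2 y, y \in W & A x y != 0.
Proof.
move=> symA ns xW; apply/exists_inP; apply: contraT; rewrite negb_exists_in.
move=> /forall_inP Ax.
suff /(_ x)/eqP : forall y, (y == x)%:R = 0 :> 'F_2 by rewrite eqxx oner_eq0.
apply: ns => [y yW|y yW]; first by case: eqVneq yW => // ->; rewrite xW.
rewrite (bigD1 x) //= eqxx mulr1 symA big1 ?addr0 => [|z /negPf->].
  by apply/eqP; rewrite -[_ == 0]negbK Ax.
by rewrite mulr0.
Qed.

Lemma mem_dm0 A : set0 \in dm_of_matrix A.
Proof. by apply/mem_dmP=> v v0 _ x; apply: v0; rewrite inE. Qed.

Lemma mem_dm1 A x : ([set x] \in dm_of_matrix A) = (A x x != 0).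
Proof.
have sum1 (v : E -> 'F_2) : (forall y, y \notin [set x] -> v y = 0) ->
    \sum_y A x y * v y = A x x * v x.
  move=> v0; rewrite (bigD1 x) //= big1 ?addr0 // => y yx.
  by rewrite v0 ?mulr0 // inE.
apply/mem_dmP/idP => [ns|Axx v v0 Av y].
  apply/negP=> /eqP Axx.
  suff /(_ x)/eqP : forall y, (y == x)%:R = 0 :> 'F_2 by rewrite eqxx oner_eq0.
  apply: ns => y; rewrite inE; [by move/negPf-> | move/eqP->].
  by rewrite sum1 ?Axx ?mul0r // => z; rewrite inE => /negPf->.
have [yx|] := boolP (y \in [set x]); last exact: v0.
have := Av x (set11 x); rewrite sum1 // => /eqP; rewrite mulf_eq0 (negPf Axx) /=.
by move: yx; rewrite inE => /eqP-> /eqP.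
Qed.

(** The formula is the 2 by 2 principal minor, because over GF(2) [A x y] is its own square and
    signs do not matter. *)
Lemma mem_dm2 A x y : symmetric_matrix A -> x != y ->
  ([set x; y] \in dm_of_matrix A) = (A x x * A y y + A x y != 0).
Proof.
move=> symA xy; have yx : y != x by rewrite eq_sym.
have sum2 z (v : E -> 'F_2) : (forall t, t \notin [set x; y] -> v t = 0) ->
    \sum_t A z t * v t = A z x * v x + A z y * v y.
  move=> v0; rewrite (bigD1 x) //= (bigD1 y) //= big1 ?addr0 // => t txy.
  by rewrite v0 ?mulr0 // !inE negb_or.
apply/mem_dmP/idP => [ns|d v v0 Av].
  apply/negP=> /eqP d0.
  pose u s r := fun z => if z == x then s else if z == y then r else 0 : 'F_2.
  have nsu s r : A x x * s + A x y * r = 0 -> A x y * s + A y y * r = 0 ->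
      s = 0 /\ r = 0.
    move=> e1 e2; have u0 : forall z, u s r z = 0.
      apply: ns => z; first by rewrite /u !inE negb_or => /andP[/negPf-> /negPf->].
      have usr : \sum_t A z t * u s r t = A z x * s + A z y * r.
        rewrite sum2 => [|t]; first by rewrite /u !eqxx (negPf yx).
        by rewrite /u !inE negb_or => /andP[/negPf-> /negPf->].
      by rewrite usr !inE => /orP[] /eqP-> //; rewrite [A y x]symA.
    by have := u0 x; have := u0 y; rewrite /u !eqxx (negPf yx).
  have dE : A x y = A x x * A y y by rewrite (addFF_eq0 d0).
  (* When the minor vanishes, [(1, 0)] is a kernel vector if [A x x = 0], and [(A y y, 1)] is one if
     [A x x = 1]. *)
  have [Axx|Axx] := eqVneq (A x x) 0.
    have := nsu 1 0; rewrite dE Axx !mul0r mulr0 addr0.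
    by move=> /(_ erefl erefl)[/eqP]; rewrite oner_eq0.
  have Axx1 : A x x = 1 by apply: FF_eq; rewrite Axx oner_eq0.
  have := nsu (A y y) 1; rewrite dE Axx1 !mul1r !mulr1 addFF.
  have -> : A y y * A y y + A y y = 0.
    by apply/eqP; case: (A y y) => [[|[|m]] mP].
  by move=> /(_ erefl erefl)[_ /eqP]; rewrite oner_eq0.
have := Av x; have := Av y; rewrite !sum2 // !inE !eqxx orbT [A y x]symA.
move=> /(_ isT) e1 /(_ isT) e2 z.
have [|zxy] := boolP (z \in [set x; y]); last exact: v0.
have /andP[/eqP vx /eqP vy] : (v x == 0) && (v y == 0).
  move: d e1 e2; case: (A x x) (A x y) (A y y) (v x) (v y) =>
    [[|[|?]] ?] [[|[|?]] ?] [[|[|?]] ?] [[|[|?]] ?] [[|[|?]] ?] // d /eqP + /eqP.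
by rewrite !inE => /orP[] /eqP->.
Qed.

(** Twisting moves [F] to [set0], so a [[set x; y]] with nonzero minor is wanted inside a
    nonsingular set: [y = x] serves if [A x x != 0], otherwise any [y] with [A x y != 0]. *)
Lemma lagrangian_exchange D : lagrangian D -> symmetric_exchange D.
Proof.
move=> lagD F F2 DF DF2 x xF; have [A [symA eqD]] := lagrangian_matrix lagD DF.
move: DF2; rewrite eqD mem_twist => FF2.
have [y yF Axy] := nonsingular_row symA (mem_dmP _ _ FF2) xF.
have [Axx|Axx] := eqVneq (A x x) 0; last first.
  by exists x => //; rewrite mem_twist symdiffK setUid mem_dm1.
exists y => //; rewrite mem_twist symdiffK mem_dm2 // ?Axx ?mul0r ?add0r //.
by apply: contraNneq Axy => <-; rewrite Axx.
Qed.

Lemma binaryP D : binary_delta_matroid D <-> D != set0 /\ lagrangian D.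
Proof.
split=> [[[D0 _] [F [A [_ symA ->]]]]|[D0 lagD]].
  split; last exact: lagrangian_twist.
  by apply/set0Pn; exists F; rewrite mem_twist symdiffxx mem_dm0.
split; first by split=> //; apply: lagrangian_exchange.
have /set0Pn[F FD] := D0; have [A [symA eqD]] := lagrangian_matrix lagD FD.
by exists F, A.
Qed.

Lemma binary_slide D a b : a != b ->
  binary_delta_matroid D -> binary_delta_matroid (handle_slide D a b).
Proof.
move=> ab /binaryP[D0 lagD]; apply/binaryP.
by split; [apply: slide_neq0 | apply: lagrangian_slide].
Qed.

Lemma binary_slides D s : (forall p, p \in s -> p.1 != p.2) ->
  binary_delta_matroid D -> binary_delta_matroid (handle_slides D s).
Proof.
elim: s D => //= -[a b] s IH D sN binD; apply: IH => [p ps|].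
  by apply: sN; rewrite inE ps orbT.
by apply: binary_slide => //; apply: (sN (a, b)); rewrite inE eqxx.
Qed.

Lemma binary_slides_inv D s : (forall p, p \in s -> p.1 != p.2) ->
  binary_delta_matroid (handle_slides D s) -> binary_delta_matroid D.
Proof.
elim: s D => //= -[a b] s IH D sN binD.
have ab : a != b by apply: (sN (a, b)); rewrite inE eqxx.
rewrite -(slideK D ab); apply: binary_slide => //; apply: IH => // p ps.
by apply: sN; rewrite inE ps orbT.
Qed.

Lemma binary_slide_stable D : binary_delta_matroid D -> slide_stable D.
Proof. by move=> binD s sN; have [] := binary_slides sN binD. Qed.
End Binary.

End LinearAlgebra.

(** * From slide stability to binarity *)

Section Stable.
Variable E : finType.
Implicit Types (K W X Y Z F : {set E}) (D : {set {set E}}) (x y : E).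

Lemma slide_stable_slides D s : (forall p, p \in s -> p.1 != p.2) ->
  slide_stable D -> slide_stable (handle_slides D s).
Proof.
move=> sN stD t tN; rewrite /handle_slides -foldl_cat; apply: stD => p.
by rewrite mem_cat => /orP[]; [apply: sN | apply: tN].
Qed.

(** Take [K] of minimum size and remove its neighbours [K - x + y] by slides. Exchange from [K]
    towards a member missing some [x] in [K] would give such a neighbour or a smaller set. *)
Lemma stable_least_set D : slide_stable D -> exists s K,
  [/\ forall p, p \in s -> p.1 != p.2, K \in handle_slides D s &
      forall F, F \in handle_slides D s -> K \subset F].
Proof.
move=> stD; have [/set0Pn[F0 F0D] _] : delta_matroid D by apply: (stD [::]).
have [K KD minK] := @arg_minnP _ F0 [in D] (fun F => #|F|) F0D.
have [s [sT KDs kill]] := kill_neighbours setT KD.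
have dis : [disjoint set0 & [set: E]] by rewrite -setI_eq0 set0I.
have small Z : #|Z| < #|K| -> Z \notin handle_slides D s.
  move=> ltZ; rewrite -[Z]set0U.
  apply: (slides_card (n := #|Z|) dis sT) => // Y _ YZ.
  by rewrite set0U; apply: contraL ltZ => /minK; rewrite -leqNgt YZ.
have [_ exD] := stD s (slides_neq sT).
exists s, K; split=> //; first exact: slides_neq sT.
move=> F FD; apply/subsetP=> x xK; apply: contraT => xF.
have [|y _] := exD K F KDs FD x; first by rewrite in_symdiff xK (negPf xF).
apply: contraLR => _; have [yK|yK] := boolP (y \in K).
  apply: small; apply: proper_card; apply/properP; split.
    apply/subsetP=> z; rewrite in_symdiff !inE.
    by have [//|zK] := boolP (z \in K) => /orP[] /eqP zE; rewrite zE ?xK ?yK in zK.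
  by exists x => //; rewrite in_symdiff xK !inE eqxx.
by rewrite setUC; apply: kill; rewrite ?inE.
Qed.

Lemma stable_binary D : slide_stable D -> binary_delta_matroid D.
Proof.
move=> stD0; have [s [K [sN]]] := stable_least_set stD0.
have := slide_stable_slides sN stD0; suff main D' : slide_stable D' ->
    K \in D' -> (forall F, F \in D' -> K \subset F) -> binary_delta_matroid D'.
  by move=> stD KD minK; apply: (binary_slides_inv sN); apply: main.
move=> {D stD0 s sN} stD KD minK.
pose d X : 'F_2 := ((symdiff K X \in D')%:R)%R.
(* The off-diagonal entry solves [d [set x; y] = A x x * A y y + A x y], so that principal minors of
   size 2 agree with [D']. *)
pose A x y : 'F_2 :=
  if x == y then d [set x] else (d [set x] * d [set y] + d [set x; y])%R.
have symA : symmetric_matrix A.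
  by move=> x y; rewrite /A eq_sym; case: eqVneq => [->//|_]; rewrite mulrC setUC.
have binH : binary_delta_matroid (twist (dm_of_matrix A) K).
  apply/binaryP; split; last exact: lagrangian_twist.
  by apply/set0Pn; exists K; rewrite mem_twist symdiffxx mem_dm0.
suff eqD : D' = twist (dm_of_matrix A) K by rewrite eqD.
pose bad Z := (symdiff K Z \in D') (+) (Z \in dm_of_matrix A).
suff good Z : ~~ bad Z.
  apply/setP=> Y; have := good (symdiff K Y).
  by rewrite mem_twist /bad symdiffK; case: (_ \in D'); case: (_ \in dm_of_matrix A).
have meetK X x : x \in K -> x \in X -> symdiff K X \notin D'.
  move=> xK xX; apply/negP=> /minK/subsetP/(_ x xK).
  by rewrite in_symdiff xK xX.
(* The row of [A] at an element of [K] is zero; together with [meetK] this keeps bad sets disjoint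
   from [K]. *)
have A0 x y : x \in K -> A x y = 0%R.
  move=> xK; have d0 X : x \in X -> d X = 0%R.
    by move=> xX; rewrite /d (negPf (meetK X x xK xX)).
  by rewrite /A (d0 [set x]) ?(d0 [set x; y]) ?inE ?eqxx // mul0r add0r if_same.
have small Y : #|Y| <= 2 -> ~~ bad Y.
  rewrite leq_eqVlt => /orP[/cards2P[x [y [xy ->]]]|].
    rewrite /bad mem_dm2 // /A !eqxx (negPf xy) addrA addFF add0r.
    by rewrite natFF_neq0 addbb.
  rewrite ltnS leq_eqVlt => /orP[/cards1P[x ->]|].
    by rewrite /bad mem_dm1 /A eqxx natFF_neq0 addbb.
  by rewrite ltnS leqn0 cards_eq0 => /eqP->; rewrite /bad symdiff0 KD mem_dm0.
apply: contraT; rewrite negbK => badZ.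
have [W badW minW] := @arg_minnP _ Z bad (fun Y => #|Y|) badZ.
have W3 : 2 < #|W| by rewrite ltnNge; apply: contraL badW => /small.
have KW : [disjoint K & W].
  rewrite -setI_eq0; apply: contraTT badW => /set0Pn[x]; rewrite inE => /andP[xK xW].
  rewrite /bad (negPf (meetK _ x xK xW)) /=; apply/negP=> /mem_dmP ns.
  by have [y _] := nonsingular_row symA ns xW; rewrite A0 ?eqxx.
have eqK Y : Y \subset W -> symdiff K Y = K :|: Y.
  move=> YW; rewrite -[in LHS](setU0 K) (symdiff_disjoint KW) ?sub0set //.
  by rewrite symdiffC symdiff0.
have defect Y : Y \subset W -> (K :|: Y \in D') =
    (K :|: Y \in twist (dm_of_matrix A) K) (+) (Y == W).
  move=> YW; rewrite -eqK // mem_twist symdiffK.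
  have [->|neqYW] := eqVneq Y W.
    by move: badW; rewrite /bad; do 2!case: (_ \in _).
  have ltYW : #|Y| < #|W| by rewrite proper_card // properEneq neqYW.
  have : ~~ bad Y by apply: contraL ltYW => /minW; rewrite -leqNgt.
  by rewrite /bad addbF; do 2!case: (_ \in _).
have stH := binary_slide_stable binH.
have KH : K \in twist (dm_of_matrix A) K by rewrite mem_twist symdiffxx mem_dm0.
have [WD|WD] := boolP (K :|: W \in D').
  by case: (no_defect KW stD stH W3 KD WD).
have WH : K :|: W \in twist (dm_of_matrix A) K.
  by have := defect W (subxx W); rewrite eqxx (negPf WD) addbT => /esym/negbFE.
by case: (no_defect KW stH stD W3 KH WH) => Y /defect ->; rewrite -addbA addbb addbF.
Qed.
End Stable.

Theorem theorem3p3 :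
  (delta_matroid_class binary_delta_matroid /\
   closed_under_handle_slides binary_delta_matroid) /\
  (forall C : set_system_class,
     delta_matroid_class C -> closed_under_handle_slides C ->
     forall (E : finType) (D : {set {set E}}),
       delta_matroid D -> ~ binary_delta_matroid D -> ~ C E D).
Proof.
split; first split.
- by move=> E F [].
- move=> E F binF s sN; have binFs := binary_slides sN binF.
  by split; first case: binFs.
move=> C _ closedC E D _ nbinD CD; apply: nbinD; apply: stable_binary => s sN.
by have [] := closedC E D CD s sN.
Qed.
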